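(* Let $(A,\phi)$ be a non-commutative probability space with unital linear map $\phi:A\to k$, and let $\Phi:H=\overline T(T(A))\to k$ be its extension as a character. Let $\beta:\overline T(T(A))\to k$ be the infinitesimal character solving $\Phi=\epsilon+\Phi\succ\beta$. For a word $w=a_1\cdots a_n\in T(A)$ set $r_n(a_1,\ldots,a_n):=\beta(w)$ and $m_n(a_1,\ldots,a_n):=\Phi(w)$. Then $$m_n(a_1,\ldots,a_n)=\sum_{I\in\mathcal B_n}r_I(a_1,\ldots,a_n),$$ where $\mathcal B_n$ is the (boolean) lattice of interval partitions of $[n]$. In particular, the $r_n(a_1,\ldots,a_n)$ are the (multivariate) boolean cumulants.
   Context: $k$ is a field of characteristic zero. A non-commutative probability space $(A,\phi)$ is an associative unital $k$-algebra $A$ (product $\cdot_A$, unit $1_A$) with a $k$-linear form $\phi:A\to k$ with $\phi(1_A)=1$. Double tensor algebra. $T(A)=\bigoplus_{n>0}A^{\otimes n}$ and $\overline T(A)=\bigoplus_{n\ge0}A^{\otimes n}$; the tensor $a_1\otimes\cdots\otimes a_n$ is written as a word $a_1\cdots a_n$ (not to be confused with the product $a_1\cdot_A\cdots\cdot_A a_n$ in $A$). $H:=\overline T(T(A))=\bigoplus_{n\ge0}T(A)^{\otimes n}$ is the unital algebra spanned by bar words $w_1|\cdots|w_m$ ($w_i\in T(A)$), with product the concatenation $|$ and unit $\mathbf 1$ (the empty word is identified with $\mathbf 1$); it is graded by the total number of letters. $H^+:=T(T(A))=\bigoplus_{n>0}T(A)^{\otimes n}$. Coproduct and its splitting. For $S=\{s_1<\cdots<s_p\}\subseteq[n]=\{1,\dots,n\}$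 put $a_S:=a_{s_1}\cdots a_{s_p}$, $a_\emptyset:=\mathbf 1$. If $J_1,\dots,J_l$ are the connected components (maximal intervals of consecutive integers, in increasing order) of $[n]\setminus S$, put $a_{J^S_{[n]}}:=a_{J_1}|\cdots|a_{J_l}$ ($=\mathbf 1$ if $S=[n]$). The coproduct $\Delta:H\to H\otimes H$ is given by $\Delta(\mathbf 1)=\mathbf 1\otimes\mathbf 1$, $\Delta(a_1\cdots a_n)=\sum_{S\subseteq[n]}a_S\otimes a_{J^S_{[n]}}$, extended multiplicatively; $\epsilon$ is the counit. On words put $\Delta^+_\prec(a_1\cdots a_n):=\sum_{1\in S\subseteq[n]}a_S\otimes a_{J^S_{[n]}}$ and $\Delta^+_\succ(a_1\cdots a_n):=\sum_{1\notin S\subset[n]}a_S\otimes a_{J^S_{[n]}}$, and extend to $H^+$ by $\Delta^+_\prec(a|b)=\Delta^+_\prec(a)\Delta(b)$, $\Delta^+_\succ(a|b)=\Delta^+_\succ(a)\Delta(b)$. Put $\Delta_\prec(a):=\Delta^+_\prec(a)-a\otimes\mathbf 1$ and $\Delta_\succ(a):=\Delta^+_\succ(a)-\mathbf 1\otimes a$ for $a\in H^+$. Half-shuffle products. For $f,g\in Lin(H^+,k)$ (viewed as forms on $H$ vanishing at $\mathbf 1$), $f\prec g:=m_k\circ(f\otimes g)\circ\Delta_\prec$ and $f\succ g:=m_k\circ(f\otimes g)\circ\Delta_\succ$, where $m_k$ is the product of $k$; half-products with the counit are $f\prec\epsilon=f=\epsilon\succ f$, $\epsilon\prec f=0=f\succ\epsilon$.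 (So for a character $\Phi$, $\Phi\succ\beta=\beta+(\Phi-\epsilon)\succ\beta$.) Characters. A character is a linear form $\Phi:H\to k$ with $\Phi(\mathbf 1)=1$ and $\Phi(w_1|w_2)=\Phi(w_1)\Phi(w_2)$ for $w_1,w_2\in H$. An infinitesimal character is a linear form $\kappa:H\to k$ with $\kappa(\mathbf 1)=0$ and $\kappa(w_1|w_2)=0$ for $w_1,w_2\in H^+$. It is known that for each character $\Phi$ there is a unique infinitesimal character $\beta$ with $\Phi=\epsilon+\Phi\succ\beta$. Extension of $\phi$. $\phi$ is extended to $T(A)$ by $\phi(a_1\cdots a_n):=\phi(a_1\cdot_A\cdots\cdot_A a_n)$, and then to the character $\Phi$ by $\Phi(\mathbf 1)=1$, $\Phi(w_1|\cdots|w_m):=\phi(w_1)\cdots\phi(w_m)$. An interval partition $I$ of $[n]$ is a partition all of whose blocks are intervals of consecutive integers; $r_I(a_1,\dots,a_n):=\prod_{B\in I}r_{|B|}(a_B)$, where for $B=\{j_1<\cdots<j_p\}$, $r_p(a_B):=r_p(a_{j_1},\dots,a_{j_p})$. The multivariate boolean cumulants are the multilinear maps $r_n$ uniquely determined by the displayed moment–cumulant relation, equivalently by the recurrence $m_n(a_1,\dots,a_n)=\sum_{j=1}^n r_j(a_1,\dots,a_j)\,m_{n-j}(a_{j+1},\dots,a_n)$ with $m_0:=1$. *)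

(* Defs.v *)
(* Mathematical Components, with excluded middle from mathcomp-classical
   (used to form quotients of vector spaces). *)
From HB Require Import structures.
From mathcomp Require Import all_boot all_order all_algebra.
From mathcomp Require Import generic_quotient ring_quotient.
From mathcomp Require Import boolp.
From mathcomp Require Import freeg.

Set Implicit Arguments.
Unset Strict Implicit.
Unset Printing Implicit Defensive.

Import GRing.Theory.
Local Open Scope ring_scope.
Local Open Scope quotient_scope.

Section FreeModule.
Context (k : fieldType) (X : choiceType).

Lemma fglift_is_linear (N : lmodType k) (g : X -> N) :
  linear (fglift g : {freeg X / k} -> N).
Proof.
have fB := lift_is_additive g.
have f0 : fglift g 0 = 0 by rewrite -(subrr 0) fB subrr.
have fN z : fglift g (- z) = - fglift g z by rewrite -[- z]sub0r fB f0 sub0r.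
have fD z1 z2 : fglift g (z1 + z2) = fglift g z1 + fglift g z2.
  by rewrite -{1}[z2]opprK fB fN opprK.
have fU a x : fglift g [freeg [:: (a, x)]] = a *: g x.
  by rewrite fglift_Freeg /prelift big_seq1.
move=> a x y; rewrite fD; congr (_ + _).
elim/freeg_ind_dom0: x => [|c x D _ _ IH]; first by rewrite scaler0 f0 scaler0.
rewrite scalerDr !fD scalerDr IH; congr (_ + _).
suff -> : a *: [freeg [:: (c, x)]] = [freeg [:: (a * c, x)]] :> {freeg X / k}.
  by rewrite !fU scalerA.
by apply/eqP/freeg_eqP => z; rewrite coeffZ !coeffU mulrA.
Qed.

HB.instance Definition _ (N : lmodType k) (g : X -> N) :=
  GRing.isLinear.Build k {freeg X / k} N *:%R (fglift g) (fglift_is_linear g).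

Definition fgen (x : X) : {freeg X / k} := [freeg [:: (1, x)]].

Lemma fglift_gen (N : lmodType k) (g : X -> N) x : fglift g (fgen x) = g x.
Proof. by rewrite fglift_Freeg /prelift big_seq1 scale1r. Qed.

Lemma freeg_gen_ind (P : {freeg X / k} -> Prop) :
  P 0 -> (forall c x D, P D -> P (c *: fgen x + D)) -> forall D, P D.
Proof.
move=> P0 PS; elim/freeg_ind_dom0 => [//|c x D _ _ /(PS c x)].
suff -> : c *: fgen x = [freeg [:: (c, x)]] :> {freeg X / k} by [].
by apply/eqP/freeg_eqP => z; rewrite coeffZ !coeffU mulrA mulr1.
Qed.

Context (rel : {freeg X / k} -> Prop).

(* The subspace spanned by rel, as the smallest one containing it. *)
Definition relspan : {pred {freeg X / k}} := fun x =>
  `[< forall P : {freeg X / k} -> Prop, (forall y, rel y -> P y) -> P 0 ->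
        (forall c y z, P y -> P z -> P (c *: y + z)) -> P x >].

Fact relspan_submod_closed : submod_closed relspan.
Proof.
split=> [|c x y /asboolP hx /asboolP hy]; first by apply/asboolP.
by apply/asboolP => P hr h0 hD; apply: (hD); [apply: hx | apply: hy].
Qed.

HB.instance Definition _ :=
  GRing.isSubmodClosed.Build k {freeg X / k} relspan relspan_submod_closed.

Lemma relspan_rel y : rel y -> y \in relspan.
Proof. by move=> ry; apply/asboolP => P hr _ _; apply: hr. Qed.

(* The vector space with generators X and relations rel. *)
Definition presented : Type := Quotient.quot relspan.

HB.instance Definition _ := GRing.Zmodule.on presented.
HB.instance Definition _ : EqQuotient _ (Quotient.equiv relspan) presented :=
  EqQuotient.on presented.

Lemma presented_eqP (x y : {freeg X / k}) :
  reflect (\pi_presented x = \pi_presented y) (x - y \in relspan).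
Proof. by rewrite (Quotient.idealrBE relspan); apply: eqP. Qed.

Lemma repr_pi_relspan x : repr (\pi_presented x) - x \in relspan.
Proof. by apply/presented_eqP; rewrite reprK. Qed.

Lemma pi_presentedD x y :
  \pi_presented (x + y) = \pi_presented x + \pi_presented y.
Proof. by rewrite [LHS](Quotient.pi_add relspan). Qed.

Definition presented_scale (c : k) (x : presented) : presented :=
  \pi_presented (c *: repr x).

Lemma pi_presentedZ c x :
  \pi_presented (c *: x) = presented_scale c (\pi_presented x).
Proof.
apply/presented_eqP; rewrite -scalerBr rpredZ //.
by rewrite -opprB rpredN repr_pi_relspan.
Qed.

Fact presented_scaleA a b v :
  presented_scale a (presented_scale b v) = presented_scale (a * b) v.
Proof.
by elim/quotW: v => v; rewrite -(pi_presentedZ b v) -(pi_presentedZ a (b *: v))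
  -(pi_presentedZ (a * b) v) scalerA.
Qed.
Fact presented_scale1 : left_id 1 presented_scale.
Proof. by elim/quotW => v; rewrite -(pi_presentedZ 1 v) scale1r. Qed.
Fact presented_scaleDr : right_distributive presented_scale +%R.
Proof.
move=> c; elim/quotW => x; elim/quotW => y.
by rewrite -pi_presentedD -(pi_presentedZ c (x + y)) -(pi_presentedZ c x)
  -(pi_presentedZ c y) -pi_presentedD scalerDr.
Qed.
Fact presented_scaleDl v :
  {morph presented_scale^~ v : a b / a + b >-> a + b}.
Proof.
by elim/quotW: v => v a b; rewrite -(pi_presentedZ (a + b) v)
  -(pi_presentedZ a v) -(pi_presentedZ b v) -pi_presentedD scalerDl.
Qed.

HB.instance Definition _ := GRing.Zmodule_isLmodule.Build k presented
  presented_scaleA presented_scale1 presented_scaleDr presented_scaleDl.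

Definition pgen (x : X) : presented := \pi_presented (fgen x).

Lemma pi_presented_is_linear : linear \pi_presented.
Proof. by move=> c x y; rewrite pi_presentedD pi_presentedZ. Qed.

Lemma presented_ind (P : presented -> Prop) :
  P 0 -> (forall c x y, P y -> P (c *: pgen x + y)) -> forall y, P y.
Proof.
move=> P0 PS; elim/quotW; elim/freeg_gen_ind => [|c x D /(PS c x)].
  suff -> : \pi_presented 0 = 0 by [].
  by rewrite -[X in \pi X](scale0r 0) pi_presentedZ; apply: scale0r.
by rewrite pi_presented_is_linear.
Qed.

(* The linear map determined by its values on the generators; it is
   meaningful when g respects the relations, cf. plift_gen, plift_linear. *)
Definition plift (N : lmodType k) (g : X -> N) (x : presented) : N :=
  fglift g (repr x).

Section Plift.
Context (N : lmodType k) (g : X -> N).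
Hypothesis g_rel : forall y, rel y -> fglift g y = 0.

Lemma plift_pi x : plift g (\pi_presented x) = fglift g x.
Proof.
apply/eqP; rewrite -subr_eq0 -raddfB /=; apply/eqP.
have /asboolP/(_ (fun z => fglift g z = 0)) := repr_pi_relspan x.
apply=> [||c y z hy hz]; [exact: g_rel | exact: raddf0|].
by rewrite fglift_is_linear hy hz scaler0 addr0.
Qed.

Lemma plift_gen x : plift g (pgen x) = g x.
Proof. by rewrite plift_pi fglift_gen. Qed.

Lemma plift_linear : linear (plift g).
Proof.
move=> c; elim/quotW => x; elim/quotW => y.
by rewrite -pi_presented_is_linear !plift_pi fglift_is_linear.
Qed.

End Plift.

End FreeModule.

Section TensorProduct.
Context (k : fieldType) (M N : lmodType k).

Variant tensor_rel : {freeg (M * N)%type / k} -> Prop :=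
| TensorRelL c x x' y : tensor_rel
    (fgen k (c *: x + x', y) - (c *: fgen k (x, y) + fgen k (x', y)))
| TensorRelR c x y y' : tensor_rel
    (fgen k (x, c *: y + y') - (c *: fgen k (x, y) + fgen k (x, y'))).

Definition tensor : Type := presented tensor_rel.
HB.instance Definition _ := GRing.Lmodule.on tensor.

Definition tens (x : M) (y : N) : tensor := pgen tensor_rel (x, y).

Lemma tensDl c x x' y : tens (c *: x + x') y = c *: tens x y + tens x' y.
Proof.
rewrite -pi_presented_is_linear; apply/presented_eqP/relspan_rel.
exact: TensorRelL.
Qed.

Lemma tensDr c x y y' : tens x (c *: y + y') = c *: tens x y + tens x y'.
Proof.
rewrite -pi_presented_is_linear; apply/presented_eqP/relspan_rel.
exact: TensorRelR.
Qed.

Lemma tensor_ind (P : tensor -> Prop) :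
  P 0 -> (forall c x y z, P z -> P (c *: tens x y + z)) -> forall z, P z.
Proof. by move=> P0 PS; apply: presented_ind => // c [x y] z; apply: PS. Qed.

Lemma tensor_ext (P : lmodType k) (f g : tensor -> P) :
  linear f -> linear g -> (forall x y, f (tens x y) = g (tens x y)) -> f =1 g.
Proof.
move=> fl gl fg.
have f0 : f 0 = 0 by have := fl (-1) 0 0; rewrite scaleN1r addNr scaleN1r addNr.
have g0 : g 0 = 0 by have := gl (-1) 0 0; rewrite scaleN1r addNr scaleN1r addNr.
by elim/tensor_ind => [|c x y z IH]; rewrite ?f0 ?g0 // fl gl fg IH.
Qed.

Definition bilin (Q : lmodType k) (f : M -> N -> Q) :=
  (forall y, linear (f^~ y)) /\ (forall x, linear (f x)).

(* The linear map x (x) y |-> f x y induced by a bilinear map f. *)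
Definition tensor_lift (Q : lmodType k) (f : M -> N -> Q) : tensor -> Q :=
  plift (fun p : M * N => f p.1 p.2).

Section TensorLift.
Context (Q : lmodType k) (f : M -> N -> Q).
Hypothesis f_bilin : bilin f.

Let f_rel y : tensor_rel y -> fglift (fun p : M * N => f p.1 p.2) y = 0.
Proof.
by case=> c *; rewrite raddfB /= fglift_is_linear !fglift_gen /=
  (f_bilin.1, f_bilin.2) subrr.
Qed.

Lemma tensor_lift_tens x y : tensor_lift f (tens x y) = f x y.
Proof. by rewrite [LHS](plift_gen f_rel). Qed.

Lemma tensor_lift_linear : linear (tensor_lift f).
Proof. exact: plift_linear f_rel. Qed.

End TensorLift.

End TensorProduct.

Section TensorAlgebra.
Context (k : fieldType) (M : lmodType k).

Definition multilinear (N : lmodType k) (f : seq M -> N) :=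
  forall u v c a b,
    f (u ++ (c *: a + b) :: v) = c *: f (u ++ a :: v) + f (u ++ b :: v).

Variant word_rel : {freeg (seq M) / k} -> Prop :=
| WordRel u v c a b : word_rel
    (fgen k (u ++ (c *: a + b) :: v) -
      (c *: fgen k (u ++ a :: v) + fgen k (u ++ b :: v))).

(* The unital tensor algebra of M: words over M, modulo multilinearity. *)
Definition tensalg : Type := presented word_rel.
HB.instance Definition _ := GRing.Lmodule.on tensalg.

Definition tword (s : seq M) : tensalg := pgen word_rel s.

Lemma tword_multilinear : multilinear tword.
Proof.
move=> u v c a b; rewrite -pi_presented_is_linear.
by apply/presented_eqP/relspan_rel; apply: WordRel.
Qed.

Lemma tensalg_ind (P : tensalg -> Prop) :
  P 0 -> (forall c s z, P z -> P (c *: tword s + z)) -> forall z, P z.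
Proof. exact: presented_ind. Qed.

(* The linear map a1 ... an |-> f [:: a1; ...; an] induced by a multilinear
   map f on words. *)
Definition tlift (N : lmodType k) (f : seq M -> N) : tensalg -> N := plift f.

Section Tlift.
Context (N : lmodType k) (f : seq M -> N).
Hypothesis f_mlin : multilinear f.

Let f_rel y : word_rel y -> fglift f y = 0.
Proof.
by case=> u v c a b; rewrite raddfB /= fglift_is_linear !fglift_gen f_mlin subrr.
Qed.

Lemma tlift_word s : tlift f (tword s) = f s.
Proof. by rewrite [LHS](plift_gen f_rel). Qed.

Lemma tlift_linear : linear (tlift f).
Proof. exact: plift_linear f_rel. Qed.

End Tlift.

Lemma tensalg_ext (N : lmodType k) (f g : tensalg -> N) :
  linear f -> linear g -> (forall s, f (tword s) = g (tword s)) -> f =1 g.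
Proof.
move=> fl gl fg.
have f0 : f 0 = 0 by have := fl (-1) 0 0; rewrite scaleN1r addNr scaleN1r addNr.
have g0 : g 0 = 0 by have := gl (-1) 0 0; rewrite scaleN1r addNr scaleN1r addNr.
by elim/tensalg_ind => [|c s z IH]; rewrite ?f0 ?g0 // fl gl fg IH.
Qed.

Definition tmul (x y : tensalg) : tensalg :=
  tlift (fun s => tlift (fun t => tword (s ++ t)) y) x.

Let cat_mlinr s : multilinear (fun t => tword (s ++ t)).
Proof. by move=> u v c a b; rewrite !catA tword_multilinear. Qed.

Let tmul_mlin y : multilinear (fun s => tlift (fun t => tword (s ++ t)) y).
Proof.
move=> u v c a b; move: y; apply: tensalg_ext.
- exact: tlift_linear.
- move=> d x y; rewrite !(tlift_linear (cat_mlinr _)) !scalerDr !scalerA.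
  by rewrite (mulrC d c) addrACA.
- by move=> t; rewrite !(tlift_word (cat_mlinr _)) -!catA tword_multilinear.
Qed.

Lemma tmul_linearl y : linear (tmul^~ y).
Proof. exact: tlift_linear. Qed.

Lemma tmul_linearr x : linear (tmul x).
Proof.
move=> d y z; move: x; apply: tensalg_ext.
- exact: tmul_linearl.
- move=> c x x'; rewrite !tmul_linearl scalerDr !scalerDr !scalerA.
  by rewrite (mulrC d c) addrACA.
- by move=> s; rewrite /tmul !(tlift_word (tmul_mlin _))
    (tlift_linear (cat_mlinr _)).
Qed.

Lemma tmul_word s t : tmul (tword s) (tword t) = tword (s ++ t).
Proof. by rewrite /tmul (tlift_word (tmul_mlin _)) (tlift_word (cat_mlinr _)). Qed.

Let tmulDl : left_distributive tmul +%R.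
Proof. by move=> x y z; rewrite -[x]scale1r tmul_linearl !scale1r. Qed.
Let tmulDr : right_distributive tmul +%R.
Proof. by move=> x y z; rewrite -[y]scale1r tmul_linearr !scale1r. Qed.
Let tmul0 x : tmul x 0 = 0.
Proof. by have := tmulDr x 0 0; rewrite addr0 => /esym/eqP; rewrite -subr_eq0 addrK => /eqP. Qed.
Let tmul0l x : tmul 0 x = 0.
Proof. by have := tmulDl 0 0 x; rewrite addr0 => /esym/eqP; rewrite -subr_eq0 addrK => /eqP. Qed.

Let tmulA : associative tmul.
Proof.
elim/tensalg_ind => [|c s x IH] y z; first by rewrite !tmul0l.
rewrite !tmul_linearl IH; congr (c *: _ + _).
elim/tensalg_ind: y => [|d t y IHy]; first by rewrite !(tmul0l, tmul0).
rewrite !(tmul_linearl, tmul_linearr) {}IHy; congr (d *: _ + _).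
elim/tensalg_ind: z => [|e w z IHz]; first by rewrite !tmul0.
by rewrite !tmul_linearr IHz !tmul_word catA.
Qed.

Let tmul1l : left_id (tword [::]) tmul.
Proof.
elim/tensalg_ind => [|c s x IH]; first by rewrite tmul0.
by rewrite tmul_linearr IH tmul_word.
Qed.

Let tmul1r : right_id (tword [::]) tmul.
Proof.
elim/tensalg_ind => [|c s x IH]; first by rewrite tmul0l.
by rewrite tmul_linearl IH tmul_word cats0.
Qed.

Definition aug : tensalg -> k^o := tlift (fun s => (s == [::])%:R : k^o).

Let aug_mlin : multilinear (fun s : seq M => (s == [::])%:R : k^o).
Proof. by case=> [|a u] v c x y /=; rewrite scaler0 addr0. Qed.

HB.instance Definition _ :=
  GRing.isLinear.Build k tensalg k^o *:%R aug (tlift_linear aug_mlin).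

Lemma aug_word s : aug (tword s) = (s == [::])%:R.
Proof. exact: (tlift_word aug_mlin). Qed.

Let tword_nil_neq0 : tword [::] != 0.
Proof.
apply/eqP => /(congr1 aug) /eqP; rewrite aug_word raddf0 /=.
exact/negP/oner_neq0.
Qed.

HB.instance Definition _ := GRing.Zmodule_isNzRing.Build tensalg
  tmulA tmul1l tmul1r tmulDl tmulDr tword_nil_neq0.

Fact tmul_scalel c (x y : tensalg) : c *: (x * y) = (c *: x) * y.
Proof. by have /= := tmul_linearl y c x 0; rewrite tmul0l !addr0 => h; apply: esym h. Qed.
HB.instance Definition _ := GRing.Lmodule_isLalgebra.Build k tensalg tmul_scalel.
Fact tmul_scaler c (x y : tensalg) : c *: (x * y) = x * (c *: y).
Proof. by have /= := tmul_linearr x c y 0; rewrite tmul0 !addr0 => h; apply: esym h. Qed.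
HB.instance Definition _ := GRing.Lalgebra_isAlgebra.Build k tensalg tmul_scaler.

Lemma tword_cat s t : tword (s ++ t) = tword s * tword t.
Proof. by rewrite [RHS]tmul_word. Qed.

Lemma tword_nil : tword [::] = 1.
Proof. by []. Qed.

(* The non-unital tensor algebra, of words of positive length. *)
Definition augker : {pred tensalg} := fun x => aug x == 0.

Fact augker_submod_closed : submod_closed augker.
Proof.
split=> [|c x y /eqP hx /eqP hy]; apply/eqP; first exact: raddf0.
by rewrite linearP /= hx hy scaler0 addr0.
Qed.
HB.instance Definition _ :=
  GRing.isSubmodClosed.Build k tensalg augker augker_submod_closed.

Record tensalgp : predArgType :=
  Tensalgp { tval : tensalg; _ : tval \in augker }.
HB.instance Definition _ := [isSub for tval].
HB.instance Definition _ := [Choice of tensalgp by <:].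
HB.instance Definition _ := [SubChoice_isSubLmodule of tensalgp by <:].

End TensorAlgebra.

Section TensorOfAlgebras.
Context (k : fieldType) (A B : algType k).
Local Notation AB := (tensor A B).

Definition tensmul (x y : AB) : AB :=
  tensor_lift (fun a b => tensor_lift (fun a' b' => tens (a * a') (b * b')) y) x.

Let tensmul_bilinr a b :
  bilin (fun a' b' => tens (a * a') (b * b') : AB).
Proof.
by split=> [b' c x y|a' c x y] /=;
  rewrite mulrDr -scalerAr (tensDl, tensDr).
Qed.

Let tensmul_bilin y :
  bilin (fun a b => tensor_lift (fun a' b' => tens (a * a') (b * b') : AB) y).
Proof.
split=> [b c x x'|a c x x']; move: y; apply: tensor_ext;
  try exact: tensor_lift_linear.
- move=> d y z; rewrite !(tensor_lift_linear (tensmul_bilinr _ _)).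
  by rewrite !scalerDr !scalerA (mulrC d c) addrACA.
- move=> a b'; rewrite !(tensor_lift_tens (tensmul_bilinr _ _)).
  by rewrite mulrDl -scalerAl tensDl.
- move=> d y z; rewrite !(tensor_lift_linear (tensmul_bilinr _ _)).
  by rewrite !scalerDr !scalerA (mulrC d c) addrACA.
- move=> a' b; rewrite !(tensor_lift_tens (tensmul_bilinr _ _)).
  by rewrite mulrDl -scalerAl tensDr.
Qed.

Lemma tensmul_linearl y : linear (tensmul^~ y).
Proof. exact: tensor_lift_linear. Qed.

Lemma tensmul_linearr x : linear (tensmul x).
Proof.
move=> d y z; move: x; apply: tensor_ext.
- exact: tensmul_linearl.
- move=> c x x'; rewrite !tensmul_linearl !scalerDr !scalerA.
  by rewrite (mulrC d c) addrACA.
- by move=> a b; rewrite /tensmul !(tensor_lift_tens (tensmul_bilin _))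
    (tensor_lift_linear (tensmul_bilinr _ _)).
Qed.

Lemma tensmul_tens a b a' b' :
  tensmul (tens a b) (tens a' b') = tens (a * a') (b * b').
Proof.
by rewrite /tensmul (tensor_lift_tens (tensmul_bilin _))
  (tensor_lift_tens (tensmul_bilinr _ _)).
Qed.

Let tensmulDl : left_distributive tensmul +%R.
Proof. by move=> x y z; rewrite -[x]scale1r tensmul_linearl !scale1r. Qed.
Let tensmulDr : right_distributive tensmul +%R.
Proof. by move=> x y z; rewrite -[y]scale1r tensmul_linearr !scale1r. Qed.
Let tensmul0 x : tensmul x 0 = 0.
Proof. by have := tensmulDr x 0 0; rewrite addr0 => /esym/eqP; rewrite -subr_eq0 addrK => /eqP. Qed.
Let tensmul0l x : tensmul 0 x = 0.
Proof. by have := tensmulDl 0 0 x; rewrite addr0 => /esym/eqP; rewrite -subr_eq0 addrK => /eqP. Qed.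

Let tensmulA : associative tensmul.
Proof.
elim/tensor_ind => [|c a b x IH] y z; first by rewrite !tensmul0l.
rewrite !tensmul_linearl IH; congr (c *: _ + _).
elim/tensor_ind: y => [|d a' b' y IHy]; first by rewrite !(tensmul0l, tensmul0).
rewrite !(tensmul_linearl, tensmul_linearr) {}IHy; congr (d *: _ + _).
elim/tensor_ind: z => [|e a'' b'' z IHz]; first by rewrite !tensmul0.
by rewrite !tensmul_linearr IHz !tensmul_tens !mulrA.
Qed.

Let tensmul1l : left_id (tens 1 1) tensmul.
Proof.
elim/tensor_ind => [|c a b x IH]; first by rewrite tensmul0.
by rewrite tensmul_linearr IH tensmul_tens !mul1r.
Qed.
Let tensmul1r : right_id (tens 1 1) tensmul.
Proof.
elim/tensor_ind => [|c a b x IH]; first by rewrite tensmul0l.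
by rewrite tensmul_linearl IH tensmul_tens !mulr1.
Qed.

HB.instance Definition _ := GRing.Zmodule_isPzRing.Build AB
  tensmulA tensmul1l tensmul1r tensmulDl tensmulDr.

Lemma tens_mul_linearl c (x y z : AB) :
  (c *: x + y) * z = c *: (x * z) + y * z.
Proof. exact: tensmul_linearl. Qed.

Lemma tens_mul_linearr c (x y z : AB) :
  x * (c *: y + z) = c *: (x * y) + x * z.
Proof. exact: tensmul_linearr. Qed.

Lemma tens1 : tens 1 1 = 1 :> AB.
Proof. by []. Qed.

Lemma tensM a b a' b' : tens a b * tens a' b' = tens (a * a') (b * b') :> AB.
Proof. exact: tensmul_tens. Qed.

End TensorOfAlgebras.

Section TensorAlgebraProj.
Context (k : fieldType) (M : lmodType k).

Fact tproj_subproof (x : tensalg M) : x - (aug x : k) *: 1 \in augker (M := M).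
Proof.
apply/eqP; rewrite linearB linearZ /= -tword_nil aug_word.
by rewrite [_ *: _]mulr1 subrr.
Qed.

(* The projection onto the non-unital tensor algebra, along the scalars. *)
Definition tproj (x : tensalg M) : tensalgp M := Tensalgp (tproj_subproof x).

Definition pword (s : seq M) : tensalgp M := tproj (tword s).

Lemma tval_pword s : s != [::] -> tval (pword s) = tword s.
Proof. by move=> /negPf s0; rewrite /= aug_word s0 scale0r subr0. Qed.

Lemma tproj_linear : linear tproj.
Proof.
move=> c x y; apply: val_inj; rewrite linearP /= linearP /= scalerDl -scalerA.
by rewrite scalerBr opprD addrACA.
Qed.

Lemma pword_multilinear : multilinear pword.
Proof. by move=> *; rewrite /pword tword_multilinear tproj_linear. Qed.

End TensorAlgebraProj.

(* Letters of s at the places in S, in increasing order; n is meant to be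
   size s, so that the default letter 0 is never used. *)
Definition subword (A : nmodType) (s : seq A) (n : nat) (S : {set 'I_n}) :
  seq A := [seq nth 0 s i | i : 'I_n <- enum S].

Section Components.
Context (n : nat) (J : {set 'I_n}).

Definition component (i : 'I_n) : {set 'I_n} :=
  [set j : 'I_n | (i <= j)%N
     & [forall l : 'I_n, (i <= l <= j)%N ==> (l \in J)]].

(* The maximal intervals contained in J, from left to right; each one is
   found from its first element. *)
Definition components : seq {set 'I_n} :=
  [seq component i | i : 'I_n <- enum J
     & [forall l : 'I_n, (l.+1 == i :> nat) ==> (l \notin J)]].

Lemma components_sub C : C \in components -> C \subset J.
Proof.
case/mapP => i _ ->; apply/subsetP => j; rewrite inE => /andP[ij /forallP h].
by have := h j; rewrite ij leqnn.
Qed.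

Lemma components_split p : p \in J -> exists L1 C L2,
  [/\ components = L1 ++ C :: L2, p \in C
    & forall D, D \in L1 ++ L2 -> p \notin D].
Proof.
move=> pJ; pose Q (i : 'I_n) := p \in component i.
have Qp : Q p.
  rewrite /Q inE leqnn; apply/forallP => l; apply/implyP; rewrite -eqn_leq.
  by move=> /eqP/val_inj <-.
case: (arg_minnP (fun i : 'I_n => i : nat) Qp) => i Qi imin.
pose st (i : 'I_n) := [forall l : 'I_n, (l.+1 == i :> nat) ==> (l \notin J)].
have iJ : i \in J.
  move: Qi; rewrite /Q inE => /andP[ip /forallP/(_ i)].
  by rewrite leqnn ip.
have sti : st i.
  apply/forallP => l; apply/implyP => /eqP li; apply/negP => lJ.
  suff /imin : Q l by rewrite -li ltnn.
  move: Qi; rewrite /Q !inE => /andP[ip /forallP h].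
  rewrite (leq_trans _ ip) -?li //=; apply/forallP => m.
  apply/implyP => /andP[lm mp]; move: lm; rewrite leq_eqVlt => /orP[/eqP|].
    by move/val_inj => <-.
  by rewrite li => im; have := h m; rewrite im mp.
have uniq_st j : j \in J -> st j -> Q j -> j = i.
  move=> jJ stj Qj; apply/val_inj/eqP; rewrite /= eqn_leq imin // andbT.
  rewrite leqNgt; apply/negP => ij.
  have j0 : (0 < j)%N by apply: leq_ltn_trans ij.
  have jn : (j.-1 < n)%N by apply: leq_ltn_trans (ltn_ord j); apply: leq_pred.
  have := forallP stj (Ordinal jn); rewrite /= prednK // eqxx /=.
  move: Qi Qj; rewrite /Q !inE => /andP[_ /forallP/(_ (Ordinal jn)) /= h].
  case/andP=> jp _; move: h; rewrite -ltnS prednK // ij.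
  by rewrite (leq_trans (leq_pred _) jp) /= => ->.
have ist : i \in [seq i <- enum J | st i] by rewrite mem_filter sti mem_enum.
have ust : uniq [seq i <- enum J | st i] by rewrite filter_uniq ?enum_uniq.
have sub j : j \in [seq i <- enum J | st i] -> j \in J /\ st j.
  by rewrite mem_filter mem_enum => /andP[-> ->].
rewrite /components -/st.
case/splitPr: ist ust sub => e1 e2; rewrite cat_uniq /= => ust sub.
exists (map component e1), (component i), (map component e2).
rewrite map_cat; split => // D; rewrite -map_cat => /mapP[j je ->].
apply/negP => Qj; case: (sub j); first by move: je; rewrite !mem_cat inE => /orP[]->; rewrite ?orbT.
move=> jJ stj; have ji := uniq_st j jJ stj Qj; subst j.
case/and4P: ust => _ /norP[n1 _] n2 _; move: je.
by rewrite mem_cat (negPf n1) (negPf n2).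
Qed.

End Components.

(* The double tensor algebra and its augmentation ideal. *)
Notation dtensalg A := (tensalg (tensalgp A)).
Notation dtensalgp A := (tensalgp (tensalgp A)).

Section DoubleTensorAlgebra.
Context (k : fieldType) (A : lmodType k).

Local Notation H := (dtensalg A).
Local Notation Hp := (dtensalgp A).
Local Notation HH := (tensor H H).

(* The word s of T(A), as an element of H; the empty word gives the unit. *)
Definition hword (s : seq A) : H := if s is [::] then 1 else tword [:: pword s].

Lemma hword_multilinear : multilinear hword.
Proof.
move=> u v c a b; have E x : hword (u ++ x :: v) = tword [:: pword (u ++ x :: v)].
  by case: u.
by rewrite !E pword_multilinear; apply: (@tword_multilinear _ _ [::] [::]).
Qed.

Definition cut (s : seq A) (n : nat) (S : {set 'I_n}) : HH :=
  tens (hword (subword s S))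
       (\prod_(J <- components (~: S)) hword (subword s J)).

Definition has_first (n : nat) (S : {set 'I_n}) : bool :=
  [exists i in S, i == 0 :> nat].

Definition delta_word (s : seq A) : HH :=
  \sum_(S : {set 'I_(size s)}) cut s S.

Definition delta_succ_word (s : seq A) : HH :=
  \sum_(S : {set 'I_(size s)} | ~~ has_first S) cut s S.

Lemma subword_out (u v : seq A) n (S : {set 'I_n}) x y :
  (forall i : 'I_n, i = size u :> nat -> i \notin S) ->
  subword (u ++ x :: v) S = subword (u ++ y :: v) S.
Proof.
move=> uS; apply/eq_in_map => i; rewrite mem_enum => iS.
rewrite !nth_cat; case: ltnP => // ui.
have : (0 < i - size u)%N.
  rewrite subn_gt0 ltn_neqAle ui andbT; apply/eqP => E.
  by have := uS i (esym E); rewrite iS.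
by case: (i - size u)%N.
Qed.

Lemma subword_in (u v : seq A) n (S : {set 'I_n}) (p : 'I_n) :
  p = size u :> nat -> p \in S ->
  exists w1 w2, forall x, subword (u ++ x :: v) S = w1 ++ x :: w2.
Proof.
move=> pu pS; have := enum_uniq S; have : p \in enum S by rewrite mem_enum.
rewrite /subword; case/splitPr => e1 e2; rewrite cat_uniq /= => H.
have [p1 p2] : p \notin e1 /\ p \notin e2 by case/and4P: H => _ /norP[? _] ? _.
exists [seq nth 0 (u ++ 0 :: v) (i : 'I_n) | i <- e1].
exists [seq nth 0 (u ++ 0 :: v) (i : 'I_n) | i <- e2] => x.
rewrite map_cat /= [X in _ ++ X :: _]nth_cat pu ltnn subnn /=.
have E (e : seq 'I_n) : p \notin e ->
    [seq nth 0 (u ++ x :: v) i | i : 'I_n <- e] =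
    [seq nth 0 (u ++ 0 :: v) i | i : 'I_n <- e].
  move=> pe; apply/eq_in_map => i ie; rewrite !nth_cat; case: ltnP => // ui.
  have : (0 < i - size u)%N.
    rewrite subn_gt0 ltn_neqAle ui andbT -pu; apply/eqP => /val_inj pi.
    by rewrite pi ie in pe.
  by case: (i - size u)%N.
by rewrite !E.
Qed.

Lemma cut_multilinear n (S : {set 'I_n}) u v c a b : (size u < n)%N ->
  cut (u ++ (c *: a + b) :: v) S =
    c *: cut (u ++ a :: v) S + cut (u ++ b :: v) S.
Proof.
move=> un; pose p := Ordinal un.
have out (T : {set 'I_n}) x y : p \notin T ->
    subword (u ++ x :: v) T = subword (u ++ y :: v) T.
  move=> pT; apply: subword_out => i iu.
  by have -> : i = p by apply: val_inj.
rewrite /cut; case: (boolP (p \in S)) => pS.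
  have [w1 [w2 Ew]] := subword_in v (erefl : p = size u :> nat) pS.
  have E x y :
      \prod_(J <- components (~: S)) hword (subword (u ++ x :: v) J) =
      \prod_(J <- components (~: S)) hword (subword (u ++ y :: v) J).
    apply: eq_big_seq => J /components_sub/subsetP JS; congr hword.
    by apply: out; apply/negP => /JS; rewrite inE pS.
  by rewrite !Ew (E _ 0) (E a 0) (E b 0) hword_multilinear tensDl.
rewrite (out S _ 0 pS) (out S a 0 pS) (out S b 0 pS).
have [L1 [C [L2 [-> pC pL]]]] : exists L1 C L2,
  [/\ components (~: S) = L1 ++ C :: L2, p \in C
    & forall D, D \in L1 ++ L2 -> p \notin D].
  by apply: components_split; rewrite inE.
have [w1 [w2 Ew]] := subword_in v (erefl : p = size u :> nat) pC.
have E L x : {subset L <= L1 ++ L2} ->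
   \prod_(J <- L) hword (subword (u ++ x :: v) J) =
   \prod_(J <- L) hword (subword (u ++ 0 :: v) J).
  by move=> LL; apply: eq_big_seq => J /LL/pL pJ; congr hword; apply: out.
have s1 : {subset L1 <= L1 ++ L2} by move=> J h; rewrite mem_cat h.
have s2 : {subset L2 <= L1 ++ L2} by move=> J h; rewrite mem_cat h orbT.
rewrite !big_cat !big_cons !(E L1 _ s1) !(E L2 _ s2) !Ew hword_multilinear /=.
by rewrite mulrDl mulrDr -scalerAl -scalerAr tensDr.
Qed.

Lemma delta_word_multilinear : multilinear delta_word.
Proof.
move=> u v c a b; rewrite /delta_word !size_cat /= scaler_sumr -big_split /=.
by apply: eq_bigr => S _; rewrite cut_multilinear // addnS ltnS leq_addr.
Qed.

Lemma delta_succ_word_multilinear : multilinear delta_succ_word.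
Proof.
move=> u v c a b; rewrite /delta_succ_word !size_cat /= scaler_sumr.
rewrite -big_split /=.
by apply: eq_bigr => S _; rewrite cut_multilinear // addnS ltnS leq_addr.
Qed.

Definition delta_T (w : tensalgp A) : HH := tlift delta_word (tval w).
Definition delta_succ_T (w : tensalgp A) : HH := tlift delta_succ_word (tval w).

Lemma delta_T_linear : linear delta_T.
Proof. by move=> c x y; rewrite [LHS](tlift_linear delta_word_multilinear). Qed.

Lemma delta_succ_T_linear : linear delta_succ_T.
Proof.
by move=> c x y; rewrite [LHS](tlift_linear delta_succ_word_multilinear).
Qed.

Definition delta_bar (ws : seq (tensalgp A)) : HH := \prod_(w <- ws) delta_T w.

Lemma delta_bar_multilinear : multilinear delta_bar.
Proof.
move=> u v c a b; rewrite /delta_bar !big_cat !big_cons /= delta_T_linear.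
by rewrite tens_mul_linearl tens_mul_linearr.
Qed.

Definition Delta : H -> HH := tlift delta_bar.

Lemma Delta_linear : linear Delta.
Proof. exact: tlift_linear delta_bar_multilinear. Qed.

Lemma Delta_tword ws : Delta (tword ws) = \prod_(w <- ws) delta_T w.
Proof. exact: tlift_word delta_bar_multilinear _. Qed.

Lemma Delta_cat ws ws' :
  Delta (tword (ws ++ ws')) = Delta (tword ws) * Delta (tword ws').
Proof. by rewrite !Delta_tword big_cat. Qed.

Lemma Delta_hword s : Delta (hword s) = delta_word s.
Proof.
case: s => [|a s].
  rewrite -[hword _]tword_nil Delta_tword big_nil /delta_word (big_pred1 set0).
    rewrite /cut /subword enum_set0 /components setC0 /=.
    by rewrite (_ : enum _ = [::]) ?big_nil //; apply: size0nil;
       rewrite -cardE cardsT card_ord.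
  by move=> S /=; apply/esym/eqP/setP => -[].
rewrite Delta_tword big_seq1 /delta_T tval_pword //.
exact: tlift_word delta_word_multilinear _.
Qed.

Definition delta_succ_bar (ws : seq (tensalgp A)) : HH :=
  if ws is w :: ws' then delta_succ_T w * Delta (tword ws') else 0.

Lemma delta_succ_bar_multilinear : multilinear delta_succ_bar.
Proof.
case=> [|w u] v c a b /=.
  by rewrite delta_succ_T_linear tens_mul_linearl.
by rewrite tword_multilinear Delta_linear tens_mul_linearr.
Qed.

Definition Delta_succ_plus (x : Hp) : HH := tlift delta_succ_bar (tval x).

Definition Delta_succ (x : Hp) : HH := Delta_succ_plus x - tens 1 (tval x).

Lemma Delta_succ_linear : linear Delta_succ.
Proof.
move=> c x y; rewrite /Delta_succ /Delta_succ_plus /=.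
rewrite (tlift_linear delta_succ_bar_multilinear) tensDr scalerBr opprD.
by rewrite addrACA.
Qed.

Definition counit : H -> k := @aug k (tensalgp A).

(* The form m_k o (f (x) g) on H (x) H, for linear forms f and g. *)
Definition form_tens (f g : H -> k) : HH -> k :=
  tensor_lift (fun x y => f x * g y : k^o).

Lemma form_tens_tens (f g : {scalar H}) x y :
  form_tens f g (tens x y) = f x * g y.
Proof.
have fg : bilin (fun x y => f x * g y : k^o).
  split=> [b c a a'|a c b b'] /=; rewrite linearP /=.
    by rewrite mulrDl -mulrA.
  by rewrite mulrDr mulrCA.
by rewrite /form_tens (tensor_lift_tens fg).
Qed.

(* Right half-shuffle of linear forms f and g that vanish at 1: the form on
   the augmentation ideal, extended by 0 at 1. *)
Definition hsucc (f g : H -> k) (x : H) : k :=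
  form_tens f g (Delta_succ (tproj x)).

(* Extension to linear forms f with any value at 1, the counit acting as a
   left identity. *)
Definition half_succ (f g : H -> k) (x : H) : k :=
  f 1 * g x + hsucc (fun y => f y - f 1 * counit y) g x.

Definition character (f : H -> k) : Prop :=
  [/\ linear_for *%R f, f 1 = 1 & forall x y : H, f (x * y) = f x * f y].

Definition infinitesimal_character (f : {scalar H}) : Prop :=
  f 1 = 0 /\ forall x y : Hp, f (tval x * tval y) = 0.

End DoubleTensorAlgebra.

Section CharacterExtension.
Context (k : fieldType) (A : algType k) (phi : {scalar A}).

Definition phi_word (s : seq A) : k^o := phi (\prod_(a <- s) a).
Definition phi_T (w : tensalgp A) : k^o := tlift phi_word (tval w).
Definition phi_bar (ws : seq (tensalgp A)) : k^o := \prod_(w <- ws) phi_T w.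

Lemma phi_word_multilinear : multilinear phi_word.
Proof.
move=> u v c a b; rewrite /phi_word !big_cat !big_cons /=.
by rewrite mulrDl mulrDr -scalerAl -scalerAr linearP.
Qed.

Lemma phi_bar_multilinear : multilinear phi_bar.
Proof.
move=> u v c a b; rewrite /phi_bar !big_cat !big_cons /=.
rewrite {2}/phi_T /= (tlift_linear phi_word_multilinear) /GRing.scale /=.
by rewrite mulrDl mulrDr -mulrA mulrCA.
Qed.

(* The extension of phi to a character of the double tensor algebra. *)
Definition Phi : dtensalg A -> k := tlift phi_bar.

Lemma Phi_tword ws : Phi (tword ws) = \prod_(w <- ws) phi_T w.
Proof. exact: tlift_word phi_bar_multilinear _. Qed.

Lemma Phi_character : character Phi.
Proof.
have lin : linear (Phi : _ -> k^o) by exact: tlift_linear phi_bar_multilinear.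
have P0 : Phi 0 = 0 by have := lin (-1) 0 0; rewrite scaleN1r addNr scaleN1r addNr.
split=> //; first by rewrite -tword_nil Phi_tword big_nil.
move=> x y; elim/tensalg_ind: x => [|c s x IH]; first by rewrite !(mul0r, P0).
rewrite mulrDl -scalerAl !lin IH /GRing.scale /= mulrDl -mulrA;
  congr (_ * _ + _).
elim/tensalg_ind: y {IH} => [|d t y IH]; first by rewrite !(mulr0, P0).
rewrite mulrDr -scalerAr !lin IH /GRing.scale /= mulrDr mulrCA;
  congr (_ * _ + _).
by rewrite -tword_cat !Phi_tword big_cat.
Qed.

Lemma Phi_hword s : phi 1 = 1 -> Phi (hword s) = phi (\prod_(a <- s) a).
Proof.
move=> phi1; case: s => [|a s].
  by rewrite big_nil phi1; case: Phi_character.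
rewrite Phi_tword big_seq1 /phi_T tval_pword //.
exact: tlift_word phi_word_multilinear _.
Qed.

End CharacterExtension.

Section BooleanCumulants.
Context (k : fieldType) (A : lmodType k).

Definition is_interval (n : nat) (B : {set 'I_n}) : bool :=
  [forall i in B, forall j in B,
     forall l : 'I_n, (i <= l <= j)%N ==> (l \in B)].

Definition interval_partition (n : nat) (P : {set {set 'I_n}}) : bool :=
  partition P [set: 'I_n] && [forall B in P, is_interval B].

(* Below, a family of n-ary maps, n > 0, is a function on words: the map of
   arity n is its restriction to words of length n. *)
Definition cumulant_prod (r : seq A -> k) (n : nat) (s : seq A)
    (P : {set {set 'I_n}}) : k :=
  \prod_(B in P) r (subword s B).

Definition moment_cumulant (m r : seq A -> k) : Prop :=
  forall (n : nat) (a : n.-tuple A), (0 < n)%N ->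
    m a = \sum_(P : {set {set 'I_n}} | interval_partition P)
            cumulant_prod r a P.

(* r is the family of boolean cumulants of the moments m. *)
Definition boolean_cumulants (m r : seq A -> k) : Prop :=
  [/\ multilinear (r : seq A -> k^o), moment_cumulant m r
    & forall r' : seq A -> k, multilinear (r' : seq A -> k^o) ->
        moment_cumulant m r' -> forall s, s != [::] -> r' s = r s].

End BooleanCumulants.

(* Main.v *)
Require Import Defs.
From HB Require Import structures.
From mathcomp Require Import all_boot all_order all_algebra.
From mathcomp Require Import zify ring.

Set Implicit Arguments.
Unset Strict Implicit.
Unset Printing Implicit Defensive.

Import GRing.Theory.
Local Open Scope ring_scope.

(** Evaluate Phi = epsilon + Phi succ beta on a nonempty word w = a_1 ... a_n.
    The right half-coproduct cuts w along the subsets S that omit the first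
    letter, and the right tensor factor is the bar word of the components of
    the complement of S.  Since beta kills the unit and every product of two
    elements of the augmentation ideal, only the S whose complement is connected
    contribute; as that complement contains the first letter, it is an initial
    interval.  The fixed-point equation is therefore the recurrence

      m(a_1 ... a_n) = sum_(1 <= j <= n) r(a_1 ... a_j) m(a_(j+1) ... a_n)

    (half_succ_hword).  The term j = n is the one that comes from the value of
    Phi at the unit.

    The sum over interval partitions satisfies the same recurrence, by splitting
    off the block that contains the first letter (suffix_partition_recurrence).
    To stay inside one index type 'I_n, partitions of the final segments
    {i, ..., n-1} are used instead of partitions of the shorter 'I_(n-i).
    Induction on the length of the segment then gives the moment-cumulant
    relation (moment_cumulant_of_recurrence).

    The cumulants are determined by the moments because the relation is
    triangular: the one-block partition contributes r(w) itself, and every other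
    partition involves r only on shorter words (moment_cumulant_inj). *)

(** * Intervals, components and interval partitions of final segments *)

Section Intervals.
Context (n : nat).

Definition intv (i j : nat) : {set 'I_n} := [set x : 'I_n | i <= x <= j]%N.
Definition suffix_set (i : nat) : {set 'I_n} := [set x : 'I_n | i <= x]%N.

Lemma setC_intv0 j : ~: intv 0 j = suffix_set j.+1.
Proof. by apply/setP => x; rewrite !inE -ltnNge. Qed.

Lemma suffix_setD_intv (i j : nat) : (i <= j)%N ->
  suffix_set i :\: intv i j = suffix_set j.+1.
Proof. by move=> ij; apply/setP => x; rewrite !inE; lia. Qed.

Lemma intv_interval i j : is_interval (intv i j).
Proof.
apply/forall_inP => x xB; apply/forall_inP => y yB; apply/forallP => l.
by move: xB yB; rewrite !inE; lia.
Qed.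

Lemma interval_intv (B : {set 'I_n}) (i : 'I_n) :
  is_interval B -> i \in B -> B \subset suffix_set i ->
  exists2 j : 'I_n, (i <= j)%N & B = intv i j.
Proof.
move=> /forall_inP itvB iB /subsetP Bi.
case: (arg_maxnP (fun j : 'I_n => j : nat) iB) => j jB jmax.
exists j; first by have := Bi _ jB; rewrite inE.
apply/setP => x; rewrite inE; apply/idP/idP => [xB|xij].
  have := Bi _ xB; rewrite inE => ix; apply/andP; split; [exact: ix | exact: jmax].
by have /forall_inP/(_ j jB)/forallP/(_ x) := itvB i iB; rewrite xij.
Qed.

Lemma component_mem (J : {set 'I_n}) i : i \in J -> i \in component J i.
Proof.
move=> iJ; rewrite inE leqnn; apply/forallP => l; apply/implyP.
by rewrite -eqn_leq => /eqP/val_inj <-.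
Qed.

(** A component contains the point from which it is generated. *)
Lemma components_neq0 (J D : {set 'I_n}) : D \in components J -> D != set0.
Proof.
case/mapP => i; rewrite mem_filter mem_enum => /andP[_ iJ] ->.
by apply/set0Pn; exists i; apply: component_mem.
Qed.

Lemma components1 (J D : {set 'I_n}) : components J = [:: D] -> D = J.
Proof.
move=> JD; apply/eqP; rewrite eqEsubset components_sub ?JD ?mem_head //=.
apply/subsetP => p /components_split[L1 [C [L2 [JC pC _]]]].
have : C \in [:: D] by rewrite -JD JC mem_cat mem_head orbT.
by rewrite inE => /eqP <-.
Qed.

(** An element of an initial interval without predecessor in it can only be 0,
    so every component contains 0, and distinct components are disjoint. *)
Lemma components_intv0 (j : 'I_n) : components (intv 0 j) = [:: intv 0 j].
Proof.
pose z : 'I_n := Ordinal (leq_ltn_trans (leq0n j) (ltn_ord j)).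
have zj : z \in intv 0 j by rewrite inE.
have zD D : D \in components (intv 0 j) -> z \in D.
  case/mapP => i; rewrite mem_filter mem_enum => /andP[/forallP st ij] ->.
  suff -> : z = i by apply: component_mem.
  apply: val_inj => /=; apply/esym/eqP; rewrite -leqn0 leqNgt; apply/negP => i0.
  have pn : (i.-1 < n)%N by apply: leq_ltn_trans (leq_pred i) (ltn_ord i).
  by have := st (Ordinal pn); move: ij; rewrite /= !inE /=; lia.
have [L1 [C [L2 [JC zC out]]]] := components_split zj.
have L0 : L1 ++ L2 = [::].
  case E: (L1 ++ L2) out zD => [//|D L] out zD; have DL : D \in D :: L.
    exact: mem_head.
  case/negP: (out D DL); apply: zD; rewrite JC mem_cat inE.
  by move: DL; rewrite -E mem_cat => /orP[]->; rewrite ?orbT.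
move: L0 JC; case: L1 out => [|//] _ /= -> JC.
by rewrite JC (components1 JC).
Qed.

(** The only case in which the infinitesimal character contributes: a set with
    a single component is an interval, which starts at 0 if it contains 0. *)
Lemma components_single (J D : {set 'I_n}) (z : 'I_n) :
  z = 0%N :> nat -> z \in J -> components J = [:: D] ->
  exists j : 'I_n, J = intv 0 j.
Proof.
move=> z0 zJ JD; have DJ := components1 JD; subst D.
have : J \in components J by rewrite JD mem_head.
case/mapP => i _ Ji; have i0 : i = z.
  by apply: val_inj; move: zJ; rewrite Ji inE /= => /andP[+ _]; lia.
subst i; have [||j _ Jj] := @interval_intv J z _ zJ; last by rewrite -z0; exists j.
  apply/forall_inP => x xJ; apply/forall_inP => y yJ; apply/forallP => l.
  apply/implyP => /andP[_ ly]; move: yJ; rewrite {1}Ji inE.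
  by case/andP => _ /forallP/(_ l); rewrite z0 ly.
by apply/subsetP => x _; rewrite inE z0.
Qed.

(** Keeping the index type 'I_n while the segment shrinks lets blocks be removed
    and added without renumbering the remaining points. *)
Definition suffix_partition (i : nat) (P : {set {set 'I_n}}) : bool :=
  partition P (suffix_set i) && [forall B in P, is_interval B].

(** The index j of the block of i is stated through a boolean equality so that
    a sum over all candidates for this block collapses to a single term. *)
Lemma suffix_partition_intv (i : 'I_n) P : suffix_partition i P ->
  exists j : 'I_n, forall l : 'I_n,
    (i <= l)%N && (intv i l \in P) = (l == j).
Proof.
case/andP => partP /forall_inP itvP; have [/eqP covP trivP P0] := and3P partP.
have iP : i \in cover P by rewrite covP inE.
have BP := pblock_mem iP; have iB : i \in pblock P i by rewrite mem_pblock.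
have Bi : pblock P i \subset suffix_set i by exact: partitionS partP BP.
have [j ij Bj] := interval_intv (itvP _ BP) iB Bi.
exists j => l; apply/andP/eqP => [[il lP]|->]; last by rewrite -Bj.
have /setP E : intv i l = intv i j.
  by rewrite -Bj (def_pblock trivP lP) // inE leqnn.
by apply: val_inj; have := E l; have := E j; rewrite !inE /=; lia.
Qed.

(** Adding the first block is a bijection, inverse to removing it, from the
    partitions of what remains; the left-hand side is the condition produced
    by reindexing a sum along this pair of maps. *)
Lemma suffix_partitionU1 (i j : 'I_n) Q : (i <= j)%N ->
  [&& suffix_partition i (intv i j |: Q), intv i j \in intv i j |: Q
    & (intv i j |: Q) :\ intv i j == Q] = suffix_partition j.+1 Q.
Proof.
move=> ij; have dis : suffix_set i :\: intv i j = suffix_set j.+1.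
  exact: suffix_setD_intv.
apply/idP/idP => [/and3P[/andP[partP /forall_inP itvP] BP /eqP EQ]|].
  apply/andP; split; first by rewrite -dis -EQ; apply: partitionD1.
  by apply/forall_inP => B BQ; apply: itvP; rewrite inE BQ orbT.
case/andP => partQ /forall_inP itvQ; have [/eqP covQ _ _] := and3P partQ.
have iB : i \in intv i j by rewrite inE leqnn.
have nQ : intv i j \notin Q.
  apply/negP => BQ; have : i \in cover Q by apply/bigcupP; exists (intv i j).
  by rewrite covQ inE; lia.
rewrite setU1K // eqxx setU11 !andbT; apply/andP; split.
  rewrite (_ : suffix_set i = intv i j :|: suffix_set j.+1); last first.
    by apply/setP => x; rewrite !inE; lia.
  apply: partitionU1 => //; first by apply/set0Pn; exists i.
  by rewrite -setI_eq0; apply/eqP/setP => x; rewrite !inE; lia.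
by apply/forall_inP => B; rewrite !inE => /orP[/eqP ->|/itvQ//]; apply: intv_interval.
Qed.

(** Classify the partitions by their first block. *)
Lemma suffix_partition_recurrence (k : fieldType) (F : {set 'I_n} -> k) (i : 'I_n) :
  \sum_(P | suffix_partition i P) \prod_(B in P) F B =
  \sum_(j : 'I_n | (i <= j)%N)
     F (intv i j) * \sum_(P | suffix_partition j.+1 P) \prod_(B in P) F B.
Proof.
(* Each partition is counted once, at the last element j of its first block. *)
transitivity (\sum_(P | suffix_partition i P)
    \sum_(j : 'I_n | (i <= j)%N && (intv i j \in P)) \prod_(B in P) F B).
  apply: eq_bigr => P /suffix_partition_intv[j Ej].
  by rewrite (eq_bigl _ _ Ej) big_pred1_eq.
rewrite (exchange_big_dep (fun j : 'I_n => i <= j)%N) /=; last first.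
  by move=> P j _ /andP[].
apply: eq_bigr => j ij; rewrite mulr_sumr.
rewrite (reindex_onto (fun Q => intv i j |: Q) (fun P => P :\ intv i j)) /=.
  apply: eq_big => [Q|Q]; first by rewrite ij -andbA suffix_partitionU1.
  case/andP => /andP[_ _] /eqP EQ; rewrite big_setU1 //.
  by rewrite -[in X in _ \notin X]EQ setD11.
by move=> P /and3P[_ _ BP]; rewrite setD1K.
Qed.

End Intervals.

(** * Subwords at intervals *)

Section Subwords.
Context (V : nmodType) (s : seq V).

Lemma size_subword n (S : {set 'I_n}) : size (subword s S) = #|S|.
Proof. by rewrite size_map -cardE. Qed.

Lemma subword_intv n i (j : 'I_n) : n = size s -> (i <= j)%N ->
  subword s (intv n i j) = take (j.+1 - i) (drop i s).
Proof.
move=> ns ij; rewrite -(map_nth_iota 0); last by rewrite -ns; have := ltn_ord j; lia.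
rewrite /subword (map_comp (nth 0 s) (fun x : 'I_n => x : nat)); congr map.
rewrite {1}/enum_mem -enumT.
(* Both sides are strictly increasing lists of naturals. *)
transitivity [seq x <- map val (enum 'I_n) | i <= x <= j]%N.
  by rewrite filter_map; congr map; apply: eq_filter => x; rewrite !inE.
rewrite val_enum_ord; apply: (irr_sorted_eq ltn_trans ltnn).
- exact: (sorted_filter ltn_trans _ (iota_ltn_sorted _ _)).
- exact: iota_ltn_sorted.
by move=> x; rewrite mem_filter !mem_iota; have := ltn_ord j; lia.
Qed.

Lemma subword_suffix_set n i : n = size s ->
  subword s (suffix_set n i) = drop i s.
Proof.
move=> ns; have [ni|] := leqP n i.
  rewrite drop_oversize -?ns //; apply: size0nil; rewrite size_subword.
  by apply: eq_card0 => x; rewrite !inE; have := ltn_ord x; lia.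
case: n ns => // n ns ni; rewrite -[RHS](@take_oversize _ (n.+1 - i)%N).
  rewrite -(subword_intv (j := @ord_max n)) //; congr subword.
  by apply/setP => x; rewrite !inE /=; have := ltn_ord x; lia.
by rewrite size_drop ns.
Qed.

End Subwords.

(** * The moment-cumulant relation *)

Section MomentCumulant.
Context (k : fieldType) (A : lmodType k).
Implicit Types m r : seq A -> k.

Lemma suffix_partition0 n : @suffix_partition n 0 =1 @interval_partition n.
Proof.
move=> P; rewrite /suffix_partition /interval_partition.
by congr (partition P _ && _); apply/setP => x; rewrite !inE.
Qed.

Definition first_block_recurrence m r := forall s, s != [::] ->
  m s = \sum_(j < size s) r (take j.+1 s) * m (drop j.+1 s).

(** Both sides obey the same recurrence in i, downward from size s, where
    the only partition of the empty segment is the empty one and contributes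
    the empty product. *)
Lemma suffix_partition_sum m r (s : seq A) i :
  m [::] = 1 -> first_block_recurrence m r ->
  \sum_(P : {set {set 'I_(size s)}} | suffix_partition i P)
    cumulant_prod r s P = m (drop i s).
Proof.
move=> m0 rec; have [d] := ubnP (size s - i); elim: d i => // d IH i id.
have [si|si] := leqP (size s) i.
  rewrite drop_oversize // m0 (big_pred1 set0) => [|P /=].
    by rewrite /cumulant_prod big_set0.
  have E0 : suffix_set (size s) i = set0.
    by apply/setP => x; rewrite !inE; have := ltn_ord x; lia.
  rewrite /suffix_partition E0 partition_set0; case: eqP => //= ->.
  by apply/forallP => B; rewrite inE.
rewrite (suffix_partition_recurrence (fun B => r (subword s B)) (Ordinal si)) /=.
rewrite rec; last by rewrite -size_eq0 size_drop subn_eq0 -ltnNge.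
rewrite size_drop.
rewrite -(big_mkord xpredT (fun l => r (take l.+1 (drop i s)) * m (drop l.+1 (drop i s)))).
transitivity (\sum_(0 + i <= j < size s)
    r (take (j.+1 - i) (drop i s)) * m (drop j.+1 s)); last first.
  rewrite big_addn; apply: eq_bigr => l _.
  by rewrite drop_drop subSn ?leq_addl // addnK addSn.
rewrite add0n big_geq_mkord; apply: eq_big => [//|j ij].
by rewrite subword_intv // IH //; lia.
Qed.

Lemma moment_cumulant_of_recurrence m r :
  m [::] = 1 -> first_block_recurrence m r -> moment_cumulant m r.
Proof.
move=> m0 rec n a _; rewrite -[in LHS](drop0 a) -(suffix_partition_sum a 0 m0 rec).
(* The index type 'I_(size a) must be identified with 'I_n. *)
have := size_tuple a; move: (size a) => p E; subst p.
by apply: eq_bigl; apply: suffix_partition0.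
Qed.

Lemma partition_setT (T : finType) (P : {set {set T}}) :
  partition P [set: T] -> [set: T] \in P -> P = [set [set: T]].
Proof.
move=> partP TP; apply/eqP; rewrite eqEsubset sub1set TP andbT.
apply/subsetP => B BP; rewrite inE; have /set0Pn[x xB] := partition_neq0 partP BP.
have tP := partition_trivIset partP.
by rewrite -(def_pblock tP BP xB) (def_pblock tP TP) ?inE.
Qed.

Lemma interval_partition_setT n : (0 < n)%N ->
  interval_partition [set [set: 'I_n]].
Proof.
move=> n0; apply/andP; split.
  rewrite /partition cover1 eqxx trivIset1 inE eq_sym.
  by apply/set0Pn; exists (Ordinal n0).
by apply/forall_inP => B; rewrite inE => /eqP ->; do 2 (apply/forall_inP => ? _);
  apply/forallP => l; rewrite inE implybT.
Qed.

(** The one-block partition isolates the value of the cumulant on the whole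
    word; all other partitions have blocks of smaller size, to which the
    induction hypothesis applies. *)
Lemma moment_cumulant_inj m r r' :
  moment_cumulant m r -> moment_cumulant m r' ->
  forall s, s != [::] -> r' s = r s.
Proof.
move=> mr mr' s; have [d] := ubnP (size s); elim: d s => // d IH s sd s0.
have n0 : (0 < size s)%N by rewrite lt0n size_eq0.
have ST q : cumulant_prod q s [set [set: 'I_(size s)]] = q s.
  rewrite /cumulant_prod big_set1 -[in RHS](drop0 s); congr q.
  by rewrite -(@subword_suffix_set _ s (size s)).
have := mr _ (in_tuple s) n0; rewrite (mr' _ (in_tuple s) n0) /=.
rewrite !(bigD1 _ (interval_partition_setT n0)) /= !ST.
rewrite (eq_bigr (fun P => cumulant_prod r s P)); first by move/addIr.
move=> P /andP[/andP[partP _] PT]; apply: eq_bigr => B BP.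
have BT : B != [set: 'I_(size s)].
  by apply: contraNneq PT => BT; rewrite (partition_setT partP) -?BT.
apply: IH.
  rewrite size_subword.
  rewrite -ltnS (leq_trans _ sd) // ltnS -[leqRHS]card_ord -cardsT proper_card //.
  by rewrite properT.
by rewrite -size_eq0 size_subword cards_eq0 (partition_neq0 partP).
Qed.

End MomentCumulant.

(** * The right half-shuffle with an infinitesimal character *)

Section HalfShuffle.
Context (k : fieldType) (A : lmodType k).
Local Notation H := (dtensalg A).

Lemma hwordE (s : seq A) : s != [::] -> hword s = tword [:: pword s].
Proof. by case: s. Qed.

Lemma prod_hword (L : seq (seq A)) : [::] \notin L ->
  \prod_(w <- L) hword w = tword [seq pword w | w <- L].
Proof.
elim: L => [|w L IH]; first by rewrite big_nil.
rewrite inE negb_or big_cons => /andP[w0 /IH ->] /=.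
by rewrite (tword_cat [:: pword w]) hwordE // eq_sym.
Qed.

(** A bar word of length at least 2 is a product of two elements of the
    augmentation ideal, and the empty bar word is the unit. *)
Lemma infinitesimal_tword (beta : {scalar H}) ws :
  infinitesimal_character beta -> size ws != 1%N -> beta (tword ws) = 0.
Proof.
case=> b1 bM; case: ws => [|w [|w' ws]] // _; rewrite (tword_cat [:: w]).
by rewrite -!(@tval_pword k (tensalgp A)) ?bM.
Qed.

Lemma Delta_succ_hword (s : seq A) : s != [::] ->
  Delta_succ (tproj (hword s)) = delta_succ_word s - tens 1 (hword s).
Proof.
move=> s0; have E := hwordE s0.
have tE : Defs.tval (tproj (hword s)) = tword [:: pword s] by rewrite E tval_pword.
rewrite /Delta_succ /Delta_succ_plus tE -E; congr (_ - _); rewrite E.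
rewrite (tlift_word (@delta_succ_bar_multilinear k A)) /= Delta_tword big_nil.
rewrite mulr1 /delta_succ_T tval_pword //.
exact: tlift_word (@delta_succ_word_multilinear k A) s.
Qed.

Lemma form_tens_linear (f g : {scalar H}) :
  linear_for *%R (form_tens f g).
Proof.
change (linear (form_tens f g : tensor H H -> k^o)).
apply: tensor_lift_linear; split=> [b c a a'|a c b b'] /=; rewrite linearP /=.
  by rewrite mulrDl -mulrA.
by rewrite mulrDr mulrCA.
Qed.
HB.instance Definition _ (f g : {scalar H}) :=
  GRing.isLinear.Build k (tensor H H) k *%R (form_tens f g)
    (form_tens_linear f g).

Section Reduced.
Context (f : {scalar H}).
(** The part f - f(1) epsilon of f that vanishes at the unit, on which the
    half-shuffle is defined; making it a linear form gives access to the
    evaluation of form_tens on pure tensors. *)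
Definition reduced (y : H) : k := f y - f 1 * counit y.

Fact reduced_is_linear : linear_for *%R reduced.
Proof.
move=> c x y; rewrite /reduced /counit linearP /= (linearP (@aug k (tensalgp A))) /=.
by rewrite [c *: _]/GRing.scale /=; ring.
Qed.
HB.instance Definition _ :=
  GRing.isLinear.Build k H k *%R reduced reduced_is_linear.

Lemma reduced1 : reduced 1 = 0.
Proof. by rewrite /reduced /counit -tword_nil aug_word mulr1 subrr. Qed.

Lemma reduced_hword s : s != [::] -> reduced (hword s) = f (hword s).
Proof.
by case: s => // a s _; rewrite /reduced /counit aug_word mulr0 subr0.
Qed.
End Reduced.

(** The cut at the complement of an initial proper interval gives one term of
    the sum; the term of the whole word is f(1) beta(w), contributed by the
    convention for half-products with the counit. *)
Lemma half_succ_hword (f beta : {scalar H}) (s : seq A) :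
  infinitesimal_character beta -> s != [::] ->
  half_succ f beta (hword s) =
    \sum_(j < size s) beta (hword (take j.+1 s)) * f (hword (drop j.+1 s)).
Proof.
move=> infb s0; have n0 : (0 < size s)%N by rewrite lt0n size_eq0.
rewrite /half_succ /hsucc Delta_succ_hword //.
rewrite -/(reduced f).
have reducedT x y :
    form_tens (reduced f) beta (tens x y) = reduced f x * beta y.
  exact: form_tens_tens.
rewrite raddfB /= [X in _ - X]reducedT reduced1 mul0r subr0.
rewrite /delta_succ_word raddf_sum /=.
set F := form_tens (reduced f) beta.
(* Only the complements of the intervals [0, j] can contribute. *)
pose h (j : 'I_(size s)) := suffix_set (size s) j.+1.
have hC j : ~: h j = intv (size s) 0 j by rewrite /h -setC_intv0 setCK.
have cutF (S : {set 'I_(size s)}) : F (cut s S) = reduced f (hword (subword s S)) *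
    beta (tword [seq pword (subword s J) | J <- components (~: S)]).
  rewrite /F /cut reducedT -(big_map (fun J : {set 'I_(size s)} => subword s J) xpredT (@hword k A)).
  rewrite prod_hword -?(map_comp (@pword k A)) //; apply/mapP => -[J /components_neq0 J0].
  by move/esym/(congr1 size)/eqP; rewrite size_subword cards_eq0 (negPf J0).
pose z := Ordinal n0.
have hinj : injective h.
  move=> i j /(congr1 (fun S => ~: S)); rewrite !hC => /setP E.
  by apply: val_inj; have := E i; have := E j; rewrite !inE /=; lia.
(* For any other S that omits 0, the complement has several components. *)
rewrite (bigID (fun S => S \in h @: setT)) /= [X in _ + (_ + X)]big1; last first.
  move=> S /andP[/existsPn first nh]; rewrite cutF.
  have zS : z \in ~: S.
    by have := first z; rewrite inE /= eqxx andbT.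
  rewrite infinitesimal_tword ?mulr0 // size_map; apply: contra nh.
  case E: (components _) => [|D [|//]] // _.
  have [j Sj] := components_single (z := z) (erefl _) zS E.
  by apply/imsetP; exists j; rewrite // /h -setC_intv0 -Sj setCK.
rewrite addr0 (eq_bigl (fun S => S \in h @: setT)); last first.
  move=> S; rewrite andbC; case: imsetP => //= -[j _ ->].
  by apply/existsP => -[i /andP[]]; rewrite !inE => + /eqP; lia.
rewrite big_imset /=; last by move=> i j _ _; apply: hinj.
have pn : ((size s).-1 < size s)%N by rewrite prednK.
have hwd (j : 'I_(size s)) : F (cut s (h j)) =
    beta (hword (take j.+1 s)) * reduced f (hword (drop j.+1 s)).
  rewrite cutF hC components_intv0 /= subword_suffix_set // subword_intv //.
  rewrite subn0 drop0 mulrC [hword (take _ _)]hwordE //.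
  by rewrite -size_eq0 size_takel.
pose l := Ordinal pn.
(* The term j = n - 1 vanishes on the left, where the reduced form is evaluated
   at the unit; on the right it is the term f(1) beta(w). *)
have ll : l.+1 = size s by rewrite /= prednK.
rewrite (bigD1 l) ?inE //= hwd [RHS](bigD1 l) //= ll take_size drop_size.
rewrite reduced1 mulr0 add0r mulrC; congr (_ + _).
apply: eq_big => [j|j /andP[_ jl]]; first by rewrite inE.
rewrite hwd reduced_hword // -size_eq0 size_drop.
by move: jl; rewrite -val_eqE /=; have := ltn_ord j; lia.
Qed.

End HalfShuffle.

(** * Boolean cumulants *)

Section PhiLinear.
Context (k : fieldType) (A : algType k) (phi : {scalar A}).
HB.instance Definition _ := GRing.isLinear.Build k (dtensalg A) k *%R (Phi phi)
  (let: And3 lin _ _ := Phi_character phi in lin).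
End PhiLinear.

Theorem theorem9 (k : fieldType) (A : algType k) (phi : {scalar A})
    (beta : {scalar (dtensalg A)}) :
  [pchar k] =i pred0 ->
  phi 1 = 1 ->
  infinitesimal_character beta ->
  (forall x : dtensalg A,
     Phi phi x = counit x + half_succ (Phi phi) beta x) ->
  let m := fun w : seq A => Phi phi (hword w) in
  let r := fun w : seq A => beta (hword w) in
  (forall (n : nat) (a : n.-tuple A), (0 < n)%N ->
     m a = \sum_(P : {set {set 'I_n}} | interval_partition P)
             \prod_(B in P) r (subword a B))
  /\ boolean_cumulants m r.
Proof.
move=> _ phi1 infb Phi_eq m r.
have m0 : m [::] = 1 by case: (Phi_character phi).
have rec : first_block_recurrence m r.
  move=> s s0; rewrite /m Phi_eq half_succ_hword //.
  by case: s s0 => // a s _; rewrite /counit aug_word add0r.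
have mr : moment_cumulant m r := moment_cumulant_of_recurrence m0 rec.
split=> //; split=> // [u v c a b|r' _ mr'].
  by rewrite /r hword_multilinear linearP.
exact: moment_cumulant_inj mr mr'.
Qed.
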